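(* Let $M$ be a smooth manifold of dimension $n$ with a pseudo-Riemannian metric $g$ of signature $(p,q)$, where $p+q=n$ and $0<q<n$. Under the general conformal transformation $g\mapsto \overline g=\sigma g$ of the metric ($\sigma$ a smooth function on $M$, $\sigma>0$), isotropic geodesics, and only such geodesics, remain invariant. That is: (i) for every smooth function $\sigma>0$ on $M$, every isotropic geodesic of $(M,g)$ is, as an unparametrized curve, an isotropic geodesic of $(M,\sigma g)$; and (ii) if a geodesic of $(M,g)$ is, as an unparametrized curve, a geodesic of $(M,\sigma g)$ for every smooth function $\sigma>0$ on $M$, then it is an isotropic geodesic of $(M,g)$.
   Context: Geodesics are considered as unparametrized curves: a smooth regular curve $x(t)$ (with $\dot x(t)\neq 0$, defined on an interval) is a geodesic of $(M,g)$ if $\nabla_{\dot x}\dot x=\varphi(t)\,\dot x$ for some function $\varphi$ along the curve, where $\nabla$ is the Levi-Civita connection of $g$ (in terms of a co-frame $\omega^i$ and connection forms $\omega^i_j$: $d\omega^i+\omega^j\omega_j^i=\alpha\,\omega^i$ along the curve for some 1-form $\alpha$, with $d$ the ordinary differential). The isotropic cone at $x\in M$ is $C_x=\{\xi\in T_x(M): g(\xi,\xi)=0\}$. An isotropic geodesic is a geodesic that is tangent to the isotropic cone $C_x$ at each of its points $x$. A geodesic of $(M,g)$ ''remains invariant under the general conformal transformation'' if, for every smooth $\sigma>0$, the same unparametrized curve is a geodesic of $(M,\sigma g)$. *)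

(* Defs.v *)
From HB Require Import structures.
From mathcomp Require Import all_boot all_order all_algebra.
From mathcomp Require Import all_classical all_reals all_analysis.
Export numFieldNormedType.Exports.
Export Order.TTheory GRing.Theory Num.Theory.

Set Implicit Arguments.
Unset Strict Implicit.
Unset Printing Implicit Defensive.

Local Open Scope classical_set_scope.
Local Open Scope ring_scope.

(* [U] is meant to be open: the functions are total and derivatives at a point
   of [U] only see their values near that point. *)
Fixpoint Ck_on (R : realType) (V W : normedModType R) (k : nat) (U : set V)
    (f : V -> W) : Prop :=
  if k is k'.+1 then
    (forall x, U x -> differentiable f x) /\
    (forall v : V, Ck_on k' U (fun x => 'D_v f x))
  else forall x, U x -> {for x, continuous f}.

Definition smooth_on (R : realType) (V W : normedModType R) (U : set V)
    (f : V -> W) : Prop := forall k, Ck_on k U f.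

(* A homeomorphism from the open set [chart_dom] onto an open subset of R^n;
   [coord] and [icoord] are total, with irrelevant values outside of
   [chart_dom] and its image. *)
Record chart (R : realType) (n : nat) (T : topologicalType) := Chart {
  chart_dom : set T ;
  coord : T -> 'rV[R]_n ;
  icoord : 'rV[R]_n -> T ;
  chart_dom_open : open chart_dom ;
  chart_im_open : open (coord @` chart_dom) ;
  coord_continuous : {within chart_dom, continuous coord} ;
  icoord_continuous : {within coord @` chart_dom, continuous icoord} ;
  coordK : forall x, chart_dom x -> icoord (coord x) = x }.

Record smooth_manifold (R : realType) (n : nat) := SmoothManifold {
  point :> topologicalType ;
  point_hausdorff : hausdorff_space point ;
  point_second_countable : @second_countable point ;
  chart_index : Type ;
  atlas : chart_index -> chart R n point ;
  atlas_cover : forall x, exists c, chart_dom (atlas c) x ;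
  atlas_smooth : forall a b,
    smooth_on (coord (atlas a) @` (chart_dom (atlas a) `&` chart_dom (atlas b)))
              (coord (atlas b) \o icoord (atlas a)) }.

Section Manifold.
Context {R : realType} {n : nat} {M : smooth_manifold R n}.
Local Notation C := (chart_index M).
Implicit Types (a b c : C) (x : M) (t : R).

Definition dom c : set M := chart_dom (atlas c).
Definition crd c : M -> 'rV[R]_n := coord (atlas c).
Definition icrd c : 'rV[R]_n -> M := icoord (atlas c).

Definition smooth_in_chart c (f : M -> R) : Prop :=
  smooth_on (crd c @` dom c) (f \o icrd c).

Definition smooth_function (f : M -> R) : Prop := forall c, smooth_in_chart c f.

Definition pderiv c (i : 'I_n) (f : M -> R) : M -> R :=
  fun x => 'D_(delta_mx 0 i) (f \o icrd c) (crd c x).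

(* Vectors are rows, so the entry (i, j) is the derivative of the j-th
   coordinate of [b] with respect to the i-th coordinate of [a]. *)
Definition transition_jacobian a b (x : M) : 'M[R]_n :=
  jacobian (crd b \o icrd a) (crd a x).

(* A tangent vector is the family of its components in all the charts around
   the base point, extended by 0 to the other charts. *)
Definition tangent_space (x : M) : set (C -> 'rV[R]_n) :=
  [set v | (forall c, ~ dom c x -> v c = 0) /\
           (forall a b, dom a x -> dom b x ->
              v b = v a *m transition_jacobian a b x)].

(* [g c x] is the matrix of the metric at x in the coordinates of [c]; it is
   only meaningful for x in [dom c]. *)
Definition tensor2 := C -> M -> 'M[R]_n.

Definition has_signature (p q : nat) (A : 'M[R]_n) : Prop :=
  (p + q)%N = n /\
  exists2 P : 'M[R]_n, P \in unitmx &
    P *m A *m P^T = diag_mx (\row_(i < n) (if (i < p)%N then 1 else -1)).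

Record pseudo_riemannian (p q : nat) (g : tensor2) : Prop := PseudoRiemannian {
  metric_smooth : forall c i j, smooth_in_chart c (fun x => g c x i j) ;
  metric_tensor : forall a b x, dom a x -> dom b x ->
    g a x = transition_jacobian a b x *m g b x *m (transition_jacobian a b x)^T ;
  metric_sym : forall c x, dom c x -> (g c x)^T = g c x ;
  metric_signature : forall c x, dom c x -> has_signature p q (g c x) }.

Definition conformal (sigma : M -> R) (g : tensor2) : tensor2 :=
  fun c x => sigma x *: g c x.

(* [Gamma c x k i j] is the component along the k-th coordinate field of the
   covariant derivative of the j-th coordinate field in the direction of the
   i-th one. *)
Definition connection_coef := C -> M -> 'I_n -> 'I_n -> 'I_n -> R.

Record affine_connection (Gamma : connection_coef) : Prop := AffineConnection {
  connection_smooth : forall c k i j,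
    smooth_in_chart c (fun x => Gamma c x k i j) ;
  connection_change : forall a b x, dom a x -> dom b x -> forall l i j,
    let J := transition_jacobian a b x in
    \sum_k Gamma a x k i j * J k l =
    pderiv a i (pderiv a j (fun y => crd b y 0 l)) x
    + \sum_r \sum_s J i r * J j s * Gamma b x l r s }.

Record levi_civita (g : tensor2) (Gamma : connection_coef) : Prop := LeviCivita {
  lc_connection : affine_connection Gamma ;
  lc_torsion_free : forall c x, dom c x -> forall k i j,
    Gamma c x k i j = Gamma c x k j i ;
  lc_metric : forall c x, dom c x -> forall k i j,
    pderiv c k (fun y => g c y i j) x =
    \sum_l (Gamma c x l k i * g c x l j + Gamma c x l k j * g c x i l) }.

(* A curve is the restriction to [I] of [x]; as usual for intervals that need
   not be open, smoothness is that of an extension to a neighbourhood. *)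
Definition smooth_curve (I : set R) (x : R -> M) : Prop :=
  exists2 U : set R, open U /\ I `<=` U &
    (forall t, U t -> {for t, continuous x}) /\
    (forall c, smooth_on (U `&` x @^-1` dom c) (crd c \o x)).

Definition velocity (x : R -> M) t : C -> 'rV[R]_n :=
  fun c => if `[< dom c (x t) >] then ((crd c \o x)^`())%classic t else 0.

(* The covariant derivative of the velocity along the curve. *)
Definition acceleration (Gamma : connection_coef) (x : R -> M) t :
    C -> 'rV[R]_n :=
  fun c => if `[< dom c (x t) >] then
      ((crd c \o x)^`(2))%classic t +
      \row_k \sum_i \sum_j
         Gamma c (x t) k i j * velocity x t c 0 i * velocity x t c 0 j
    else 0.

Definition regular_curve (I : set R) (x : R -> M) : Prop :=
  [/\ is_interval I, I^° !=set0, smooth_curve I x &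
      forall t, I t -> velocity x t <> 0].

(* The condition is invariant under reparametrization: it is a property of the
   unparametrized curve. The Levi-Civita connection of a metric is unique. *)
Definition geodesic (g : tensor2) (I : set R) (x : R -> M) : Prop :=
  regular_curve I x /\
  exists2 Gamma : connection_coef, levi_civita g Gamma &
    exists phi : R -> R, forall t, I t ->
      acceleration Gamma x t = phi t *: velocity x t.

Definition isotropic_cone (g : tensor2) (x : M) : set (C -> 'rV[R]_n) :=
  [set v | tangent_space x v /\
           forall c, dom c x -> (v c *m g c x *m (v c)^T) 0 0 = 0].

Definition isotropic_geodesic (g : tensor2) (I : set R) (x : R -> M) : Prop :=
  geodesic g I x /\ forall t, I t -> isotropic_cone g (x t) (velocity x t).

End Manifold.

Arguments tensor2 {R n} M.
Arguments connection_coef {R n} M.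

(* Main.v *)
(** Under [g -> sigma g] the Christoffel symbols change by
      2 D^k_ij = d^k_i a_j + d^k_j a_i - g_ij g^kl a_l,   a = d (ln sigma),
    so the covariant acceleration of a curve with velocity v changes by
      a(v) v - g(v,v)/2 grad (ln sigma).
    If g(v,v) = 0 this is a multiple of v, which gives (i).  If g(v,v) <> 0 at
    some point, choose sigma so that a is there a nonzero covector that vanishes
    on v (possible as n >= 2): a multiple of v in the change would then make
    grad (ln sigma) proportional to v, hence a(v) <> 0, a contradiction.  Such a
    sigma is 1 plus a smooth bump function in a chart, whose centre is slightly
    moved away from the point in the direction of a; it is smooth outside of the
    chart because M is Hausdorff. *)
Require Import Defs.
From mathcomp Require Import all_boot all_order all_algebra.
From mathcomp Require Import all_classical all_reals all_analysis.
From mathcomp Require Import ring lra.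

Import Order.TTheory GRing.Theory Num.Theory numFieldNormedType.Exports.

Set Implicit Arguments.
Unset Strict Implicit.
Unset Printing Implicit Defensive.

Local Open Scope classical_set_scope.
Local Open Scope ring_scope.

(** * Calculus of [Ck_on]: locality, algebraic operations, inverse matrices *)

Section SmoothFunctions.
Context {R : realType}.
Implicit Types (V W : normedModType R).

(** The first-order expansion of [f] at [x] also holds for [g], and uniqueness of the differential
    identifies ['d g x] with ['d f x]. *)
Lemma near_eq_differentiable V W (f g : V -> W) x :
  (\near x, f x = g x) -> differentiable f x -> differentiable g x.
Proof.
move=> fg df.
have [dfc fE] := (diff_locallyP _ _).1 df.
have gE : g \o shift x = cst (g x) + 'd f x +o_ (0 : V) id.
  apply/eqaddoP => e e0.
  have := (eqaddoP _ _ _ _).1 fE e e0.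
  have fg0 : \forall h \near 0, f (h + x) = g (h + x).
    by move: fg; rewrite (near_shift 0) /= subr0.
  apply: filterS2 fg0 => h /= fgh.
  by rewrite !fctE /= -(nbhs_singleton fg) fgh.
have dgE : 'd g x = 'd f x :> (V -> W) by exact: diff_unique.
by apply/diff_locallyP; rewrite dgE.
Qed.

(** Since [U] is open, equality on [U] is equality near each of its points, so it passes to
    directional derivatives. *)
Lemma Ck_on_eq V W k (U : set V) (f g : V -> W) : open U ->
  (forall x, U x -> f x = g x) -> Ck_on k U f -> Ck_on k U g.
Proof.
move=> oU; elim: k f g => [|k IH] f g fg /=.
  move=> fc x Ux; have nU : nbhs x U by exact: open_nbhs_nbhs.
  have fgx : \forall y \near x, f y = g y by apply: filterS nU => y /fg.
  by apply: cvg_trans (near_eq_cvg fgx) _; rewrite -(fg x Ux); exact: fc.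
have nfg x : U x -> \forall y \near x, f y = g y.
  move=> Ux; have nU : nbhs x U by exact: open_nbhs_nbhs.
  by apply: filterS nU => y /fg.
move=> [df Df]; split.
  by move=> x Ux; apply: near_eq_differentiable (df x Ux); exact: nfg.
move=> v; apply: IH (Df v) => x Ux.
by apply: near_eq_derive; exact: nfg.
Qed.

(** [Ck_on] imposes pointwise conditions on a total function, so they may be verified at each point
    on a set of its own. *)
Lemma Ck_on_local V W k (U : set V) (f : V -> W) :
  (forall x, U x -> exists2 A, A x & Ck_on k A f) -> Ck_on k U f.
Proof.
elim: k f => [|k IH] f /= fU.
  by move=> x /fU[A Ax]; exact.
split; first by move=> x /fU[A Ax [+ _]]; exact.
by move=> v; apply: IH => x /fU[A Ax [_ Df]]; exists A.
Qed.

Lemma Ck_onW V W k (U : set V) (f : V -> W) : Ck_on k.+1 U f -> Ck_on k U f.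
Proof.
elim: k f => [|k IH] f [df Df].
  by move=> x /df; exact: differentiable_continuous.
by split=> // v; apply: IH; exact: Df.
Qed.

Lemma Ck_on_cst V W k (U : set V) (c : W) : Ck_on k U (fun=> c).
Proof.
elim: k c => [|k IH] c /=; first by move=> x _; exact: cst_continuous.
split=> [x _|v]; first exact: differentiable_cst.
rewrite (_ : 'D_v _ = fun=> 0) ?funeqE //.
by move=> x; exact: derive_cst.
Qed.

Section OpenDomain.
Variables (V : normedModType R) (U : set V).
Hypothesis oU : open U.

Lemma Ck_onD W k (f g : V -> W) :
  Ck_on k U f -> Ck_on k U g -> Ck_on k U (fun x => f x + g x).
Proof.
elim: k f g => [|k IH] f g.
  by move=> fc gc x Ux; apply: cvgD; [exact: fc|exact: gc].
move=> [df Df] [dg Dg]; split.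
  by move=> x Ux; apply: differentiableD; [exact: df|exact: dg].
move=> v; apply: Ck_on_eq (IH _ _ (Df v) (Dg v)) => // x Ux.
by rewrite -deriveD//; apply: diff_derivable; [exact: df|exact: dg].
Qed.

Lemma Ck_onM k (f g : V -> R) :
  Ck_on k U f -> Ck_on k U g -> Ck_on k U (fun x => f x * g x).
Proof.
elim: k f g => [|k IH] f g.
  by move=> fc gc x Ux; apply: cvgM; [exact: fc|exact: gc].
move=> cf cg; have [df Df] := cf; have [dg Dg] := cg; split.
  by move=> x Ux; apply: differentiableM; [exact: df|exact: dg].
move=> v; apply: (@Ck_on_eq _ _ _ _
  (fun x => f x * 'D_v g x + g x * 'D_v f x)) => // [x Ux|].
  by rewrite deriveM//; apply: diff_derivable; [exact: df|exact: dg].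
apply: Ck_onD; first exact: IH (Ck_onW cf) (Dg v).
exact: IH (Ck_onW cg) (Df v).
Qed.

Lemma Ck_on_sum (I : Type) (r : seq I) (P : pred I) W k (f : I -> V -> W) :
  (forall i, Ck_on k U (f i)) ->
  Ck_on k U (fun x => \sum_(i <- r | P i) f i x).
Proof.
move=> cf; elim: r => [|i r IH].
  by rewrite (_ : (fun x => _) = fun=> 0) ?funeqE;
    [exact: Ck_on_cst|move=> x; rewrite big_nil].
have [Pi|nPi] := boolP (P i).
  rewrite (_ : (fun x => _) =
      (fun x => f i x + \sum_(j <- r | P j) f j x)); first exact: Ck_onD.
  by rewrite funeqE => x; rewrite big_cons Pi.
rewrite (_ : (fun x => _) = (fun x => \sum_(j <- r | P j) f j x)) //.
by rewrite funeqE => x; rewrite big_cons (negbTE nPi).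
Qed.

Lemma Ck_on_prod (I : Type) (r : seq I) (P : pred I) k (f : I -> V -> R) :
  (forall i, Ck_on k U (f i)) ->
  Ck_on k U (fun x => \prod_(i <- r | P i) f i x).
Proof.
move=> cf; elim: r => [|i r IH].
  by rewrite (_ : (fun x => _) = fun=> 1) ?funeqE;
    [exact: Ck_on_cst|move=> x; rewrite big_nil].
have [Pi|nPi] := boolP (P i).
  rewrite (_ : (fun x => _) =
      (fun x => f i x * \prod_(j <- r | P j) f j x)); first exact: Ck_onM.
  by rewrite funeqE => x; rewrite big_cons Pi.
rewrite (_ : (fun x => _) = (fun x => \prod_(j <- r | P j) f j x)) //.
by rewrite funeqE => x; rewrite big_cons (negbTE nPi).
Qed.

Lemma derive_comp1 (F : R -> R) (f : V -> R) (x v : V) :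
  differentiable F (f x) -> differentiable f x ->
  'D_v (F \o f) x = F^`()%classic (f x) * 'D_v f x.
Proof.
move=> dF df.
rewrite deriveE; last exact: differentiable_comp.
rewrite diff_comp //= derive1E !deriveE // -[X in 'd _ _ X]mulr1.
by rewrite [LHS]linearZ mulrC.
Qed.

(** The derivative of [1/f] is [-(1/f)^2 Df], where [1/f] is needed only to order [k]; this closes
    the induction. *)
Lemma Ck_onV k (f : V -> R) : (forall x, U x -> f x != 0) ->
  Ck_on k U f -> Ck_on k U (fun x => (f x)^-1).
Proof.
move=> f0; elim: k => [|k IH].
  by move=> fc x Ux; apply: cvgV; [exact: f0|exact: fc].
move=> cf; have [df Df] := cf; split.
  by move=> x Ux; apply: differentiableV; [exact: df|exact: f0].
move=> v; apply: (@Ck_on_eq _ _ _ _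
  (fun x => -1 * ((f x)^-1 * (f x)^-1 * 'D_v f x))) => // [x Ux|].
  rewrite (@deriveV _ _ f); [|exact: f0|exact/diff_derivable/df].
  by rewrite /GRing.scale /= -exprVn; ring.
apply: Ck_onM; first exact: Ck_on_cst.
have cV := IH (Ck_onW cf).
exact: Ck_onM (Ck_onM cV cV) (Df v).
Qed.

Lemma derive_coord m n (f : V -> 'M[R]_(m, n)) (x v : V) i j :
  differentiable f x -> 'D_v (fun y => f y i j) x = 'D_v f x i j.
Proof.
by move=> df; rewrite [in RHS]derive_mx ?mxE//; exact: diff_derivable.
Qed.

Lemma Ck_on_coord m n k (f : V -> 'M[R]_(m, n)) i j :
  Ck_on k U f -> Ck_on k U (fun x => f x i j).
Proof.
elim: k f => [|k IH] f.
  move=> fc x Ux.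
  apply: (@continuous_comp _ _ _ f (fun A : 'M[R]_(m, n) => A i j)).
    exact: fc.
  exact: coord_continuous.
move=> [df Df]; split=> [x Ux|v].
  apply: (@differentiable_comp _ _ _ _ f (fun A : 'M[R]_(m, n) => A i j)).
    exact: df.
  exact: differentiable_coord.
apply: Ck_on_eq (IH _ (Df v)) => // x Ux.
by rewrite derive_coord//; exact: df.
Qed.

Lemma Ck_on_det n k (A : V -> 'M[R]_n) :
  (forall i j, Ck_on k U (fun x => A x i j)) -> Ck_on k U (fun x => \det (A x)).
Proof.
move=> cA; apply: Ck_on_sum => s.
apply: Ck_onM; first exact: Ck_on_cst.
exact: Ck_on_prod.
Qed.

Lemma Ck_on_cofactor n k (A : V -> 'M[R]_n) i j :
  (forall i j, Ck_on k U (fun x => A x i j)) ->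
  Ck_on k U (fun x => cofactor (A x) i j).
Proof.
move=> cA; apply: Ck_onM; first exact: Ck_on_cst.
apply: Ck_on_det => a b; apply: Ck_on_eq (cA (lift i a) (lift j b)) => // x _.
by rewrite !mxE.
Qed.

(** Cramer's rule: the entries are cofactors divided by the determinant. This serves for the inverse
    of the metric. *)
Lemma Ck_on_invmx n k (A : V -> 'M[R]_n) i j :
  (forall x, U x -> A x \in unitmx) ->
  (forall i j, Ck_on k U (fun x => A x i j)) ->
  Ck_on k U (fun x => invmx (A x) i j).
Proof.
move=> uA cA; apply: (@Ck_on_eq _ _ _ _
  (fun x => (\det (A x))^-1 * cofactor (A x) j i)) => // [x Ux|].
  by rewrite /invmx uA// !mxE.
apply: Ck_onM; last exact: Ck_on_cofactor.
apply: Ck_onV; last exact: Ck_on_det.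
by move=> x /uA; rewrite unitmxE unitfE.
Qed.

End OpenDomain.

End SmoothFunctions.

(** * The flat functions [s^-m exp(-1/s)] and their smoothness *)

Section FlatFunction.
Context {R : realType}.

(* The family is closed under derivation, unlike [exp (- 1 / s)] alone. *)
Definition flat (m : nat) (s : R) : R :=
  if 0 < s then s^-1 ^+ m * expR (- s^-1) else 0.

Lemma flat_gt0 m s : 0 < s -> 0 < flat m s.
Proof.
by move=> s0; rewrite /flat s0 mulr_gt0 ?expR_gt0// exprn_gt0// invr_gt0.
Qed.

Lemma flat_le0 m s : s <= 0 -> flat m s = 0.
Proof. by rewrite /flat ltNge => ->. Qed.

Lemma flat_ge0 m s : 0 <= flat m s.
Proof.
by have [/(flat_le0 m)->//|s0] := leP s 0; exact/ltW/flat_gt0.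
Qed.

(** Trades an index for a power of [s]; this yields both the quadratic bound and the difference
    quotient at 0. *)
Lemma flatS m s : flat m s = flat m.+1 s * s.
Proof.
have [s0|s0] := leP s 0; first by rewrite !flat_le0// mul0r.
by rewrite /flat s0 exprSr mulrAC mulfVK// gt_eqF.
Qed.

(** One term of the exponential series, [exp(1/s) >= s^-(m+2) / (m+2)!], bounds [flat m.+2 s] by
    [(m+2)!]; two uses of [flatS] supply [s^2]. *)
Lemma flat_le_sqr m s : flat m s <= m.+2`!%:R * s ^+ 2.
Proof.
have [s0|s0] := leP s 0; first by rewrite flat_le0// mulr_ge0// sqr_ge0.
rewrite flatS [flat m.+1 s]flatS -mulrA -expr2 ler_wpM2r ?sqr_ge0//.
rewrite /flat s0 expRN.
have := @expR_ge1Dxn R s^-1 m.+1 (ltW _); rewrite invr_gt0 => /(_ s0) le_e.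
rewrite ler_pdivrMr ?expR_gt0// -ler_pdivrMl ?ltr0n ?fact_gt0// mulrC.
by apply: le_trans le_e; rewrite lerDr.
Qed.

Lemma flat_continuous0 m : {for 0, continuous (flat m)}.
Proof.
rewrite /prop_for /continuous_at (flat_le0 m (lexx 0)).
apply: (@squeeze_cvgr _ _ _ _ (cst 0) (fun s => m.+2`!%:R * s ^+ 2)).
- by near=> s; rewrite flat_ge0 flat_le_sqr.
- exact: cvg_cst.
- rewrite -[X in _ --> X](mulr0 m.+2`!%:R).
  apply: cvgMr; rewrite -[X in _ --> X](mulr0 0).
  by under eq_fun do rewrite expr2; apply: cvgM; exact: cvg_id.
Unshelve. all: by end_near. Qed.

Lemma is_derive_flat m (s : R) :
  is_derive s 1 (flat m) (- m%:R * flat m.+1 s + flat m.+2 s).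
Proof.
have [s0|s0|->] := ltgtP s 0.
- rewrite !flat_le0 ?(ltW s0)// mulr0 addr0.
  apply: (@near_eq_is_derive _ _ _ (cst 0)).
  near=> t; rewrite flat_le0//; apply: ltW; near: t; exact: lt_nbhsl.
- apply: (@near_eq_is_derive _ _ _
    (((fun t : R => t^-1) ^+ m : R -> R) * (expR \o (fun t => - t^-1)))).
    near=> t; rewrite /flat ifT ?fctE ?exprfctE//; near: t; exact: lt_nbhsr.
  have sn0 : s != 0 by rewrite gt_eqF.
  have dV : is_derive s 1 (fun t : R => t^-1) (- s ^- 2 *: 1).
    exact: (@is_deriveV _ id).
  have dX : is_derive s 1 ((fun t : R => t^-1) ^+ m : R -> R)
    ((m%:R * s^-1 ^+ m.-1) *: (- s ^- 2 *: 1)) by exact: is_deriveX.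
  have dE : is_derive s 1 (expR \o (fun t : R => - t^-1))
    (expR (- s^-1) * - (- s ^- 2 *: 1)).
    by apply: is_derive1_comp; exact: is_deriveN.
  apply: is_derive_eq (is_deriveM dX dE) _.
  rewrite /flat s0 /GRing.scale /= !mulr1 -!exprVn.
  case: m {dX} => [|m]; rewrite /= ?exprfctE /= ?mulr0n ?oppr0 ?expr0 ?exprS.
    by ring.
  by rewrite -natr1; ring.
- rewrite !flat_le0// mulr0 addr0.
  (* By [flatS] the slope of [flat m] between 0 and [z] is [flat m.+1 z], which tends to 0 at 0. *)
  apply/is_derive1_caratheodory; exists (flat m.+1); split.
  + by move=> z; rewrite [flat m 0]flat_le0// !subr0 flatS.
  + exact: flat_continuous0.
  + by rewrite flat_le0.
Unshelve. all: by end_near. Qed.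

Lemma differentiable_flat m (s : R) : differentiable (flat m) s.
Proof. by apply/derivable1_diffP; case: (is_derive_flat m s). Qed.

(** Differentiation raises the index of [flat], so the induction on [k] keeps [m] general. *)
Lemma Ck_on_flat (V : normedModType R) (U : set V) m k (f : V -> R) :
  open U -> Ck_on k U f -> Ck_on k U (fun x => flat m (f x)).
Proof.
move=> oU; elim: k m => [|k IH] m.
  move=> fc x Ux; apply: (@continuous_comp _ _ _ f (flat m)); first exact: fc.
  exact/differentiable_continuous/differentiable_flat.
move=> cf; have [df Df] := cf; split.
  move=> x Ux; apply: (@differentiable_comp _ _ _ _ f (flat m)).
    exact: df.
  exact: differentiable_flat.
move=> v; apply: (@Ck_on_eq _ _ _ _ _ (fun x =>
    (- m%:R * flat m.+1 (f x) + flat m.+2 (f x)) * 'D_v f x)) => // [x Ux|].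
  rewrite (@derive_comp1 _ _ (flat m)); last by exact: df.
    by rewrite derive1E (@derive_val _ _ _ _ _ _ _ (is_derive_flat m (f x))).
  exact: differentiable_flat.
have cW m' := IH m' (Ck_onW cf).
apply: (Ck_onM oU) (Df v); apply: (Ck_onD oU) (cW _).
exact: (Ck_onM oU) (Ck_on_cst _ _ _) (cW _).
Qed.

End FlatFunction.

(** * Pointwise algebra of the change of Christoffel symbols *)

Section ConformalCorrection.
Context {R : realType} {n : nat}.
Implicit Types (A B J : 'M[R]_n) (al be v : 'rV[R]_n).

(* The difference of the Christoffel symbols of [sigma g] and of [g], where [A]
   is the matrix of [g] and [al] the differential of [ln sigma]. *)
Definition conformal_correction A al (k i j : 'I_n) : R :=
  2^-1 * ((k == i)%:R * al 0 j + (k == j)%:R * al 0 i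
          - A i j * (al *m invmx A) 0 k).

Lemma conformal_correctionC A al k i j : A^T = A ->
  conformal_correction A al k i j = conformal_correction A al k j i.
Proof.
move=> sA; rewrite /conformal_correction.
have -> : A i j = A j i by rewrite -[in LHS]sA mxE.
by ring.
Qed.

Lemma sum_delta (F : 'I_n -> R) i : \sum_k (k == i)%:R * F k = F i.
Proof.
rewrite (bigD1 i)//= eqxx mul1r big1 ?addr0// => k /negbTE->.
by rewrite mul0r.
Qed.

(** The upper index is contracted with an arbitrary [w], so that one formula covers both lowering by
    the metric and multiplication by a Jacobian. *)
Lemma sum_conformal_correction A al i j (w : 'I_n -> R) :
  \sum_k conformal_correction A al k i j * w k =
  2^-1 * (w i * al 0 j + w j * al 0 i
          - A i j * \sum_k (al *m invmx A) 0 k * w k).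
Proof.
rewrite -(sum_delta w i) -(sum_delta w j) !mulr_suml mulr_sumr.
rewrite -big_split -sumrB mulr_sumr /=.
by apply: eq_bigr => k _; rewrite /conformal_correction; ring.
Qed.

Lemma conformal_correction_lower A al k i j : A \in unitmx ->
  \sum_l conformal_correction A al l k i * A l j =
  2^-1 * (A k j * al 0 i + A i j * al 0 k - A k i * al 0 j).
Proof.
move=> uA; rewrite (sum_conformal_correction _ _ _ _ (fun l => A l j)).
by rewrite -[in al 0 j](mulmxKV uA al) [in RHS]mxE.
Qed.

(** The correction is a tensor: as a difference of two connections, it transforms without second
    derivatives of the coordinates. *)
Lemma conformal_correction_change A B J al be l i j :
  A = J *m B *m J^T -> al = be *m J^T -> J \in unitmx -> B \in unitmx ->
  \sum_k conformal_correction A al k i j * J k l =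
  \sum_r \sum_s J i r * J j s * conformal_correction B be l r s.
Proof.
move=> AE alE uJ uB.
rewrite (sum_conformal_correction _ _ _ _ (fun k => J k l)).
(* The covector [al] with its index raised transforms as a vector. *)
have -> : \sum_k (al *m invmx A) 0 k * J k l = (be *m invmx B) 0 l.
  suff <- : al *m invmx A *m J = be *m invmx B by rewrite [in RHS]mxE.
  have uA : A \in unitmx by rewrite AE !unitmx_mul uJ uB unitmx_tr uJ.
  suff -> : al = be *m invmx B *m invmx J *m A.
    by rewrite mulmxK// mulmxKV.
  by rewrite AE !mulmxA mulmxKV// mulmxKV.
set c := (be *m _) 0 l.
have al_sum i' : al 0 i' = \sum_s be 0 s * J i' s.
  by rewrite alE mxE; apply: eq_bigr => s _; rewrite mxE.
(* [E1], [E2] and [E3] transform the three terms of the correction separately. *)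
have E1 : \sum_r \sum_s J i r * J j s * ((r == l)%:R * be 0 s) = J i l * al 0 j.
  rewrite -(sum_delta (J i) l) mulr_suml; apply: eq_bigr => r _.
  by rewrite al_sum mulr_sumr; apply: eq_bigr => s _; ring.
have E2 : \sum_r \sum_s J i r * J j s * ((s == l)%:R * be 0 r) = J j l * al 0 i.
  rewrite -(sum_delta (J j) l) mulr_suml exchange_big; apply: eq_bigr => s _.
  by rewrite al_sum mulr_sumr; apply: eq_bigr => r _; ring.
have E3 : \sum_r \sum_s J i r * J j s * B r s = A i j.
  rewrite exchange_big AE mxE; apply: eq_bigr => s _.
  by rewrite !mxE mulr_suml; apply: eq_bigr => r _; ring.
rewrite -E1 -E2 -E3 !pair_big /= mulr_suml -big_split -sumrB mulr_sumr /=.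
apply: eq_bigr => -[r s] _ /=; rewrite /conformal_correction -/c.
by rewrite (eq_sym l r) (eq_sym l s); ring.
Qed.

Lemma sum_quad A v :
  \sum_i \sum_j A i j * v 0 i * v 0 j = (v *m A *m v^T) 0 0.
Proof.
rewrite exchange_big [RHS]mxE; apply: eq_bigr => j _.
by rewrite !mxE mulr_suml; apply: eq_bigr => i _; rewrite (mulrC (v 0 i)).
Qed.

(** Each of the two Kronecker terms contributes half of [al(v) v]; the third gives the multiple of
    the raised covector. *)
Lemma conformal_correction_quad A al v k :
  \sum_i \sum_j conformal_correction A al k i j * v 0 i * v 0 j =
  (v *m al^T) 0 0 * v 0 k
  - 2^-1 * (v *m A *m v^T) 0 0 * (al *m invmx A) 0 k.
Proof.
set c := (al *m _) 0 k.
have E1 : \sum_i \sum_j (i == k)%:R * al 0 j * v 0 i * v 0 j =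
    (v *m al^T) 0 0 * v 0 k.
  rewrite mulrC -(sum_delta (v 0) k) mulr_suml; apply: eq_bigr => i _.
  by rewrite !mxE mulr_sumr; apply: eq_bigr => j _; rewrite mxE; ring.
have E2 : \sum_i \sum_j (j == k)%:R * al 0 i * v 0 i * v 0 j =
    (v *m al^T) 0 0 * v 0 k.
  rewrite -E1 exchange_big; apply: eq_bigr => i _.
  by apply: eq_bigr => j _; ring.
transitivity (2^-1 * ((v *m al^T) 0 0 * v 0 k + (v *m al^T) 0 0 * v 0 k
    - (v *m A *m v^T) 0 0 * c)); last by field.
rewrite -{1}E1 -E2 -sum_quad !pair_big /= mulr_suml -big_split.
rewrite -sumrB mulr_sumr /=.
apply: eq_bigr => -[i j] _ /=; rewrite /conformal_correction -/c.
by rewrite (eq_sym k i) (eq_sym k j); ring.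
Qed.

(** Same argument as for the uniqueness of the Levi-Civita connection; [S] stands for a difference
    of Christoffel symbols. *)
Lemma conformal_correction_unique A al (S : 'I_n -> 'I_n -> 'I_n -> R) :
  A^T = A -> A \in unitmx -> (forall k i j, S k i j = S k j i) ->
  (forall k i j,
     \sum_l (S l k i * A l j + S l k j * A i l) = al 0 k * A i j) ->
  forall k i j, S k i j = conformal_correction A al k i j.
Proof.
move=> sA uA sS SA k i j.
have AC a b : A a b = A b a by rewrite -[in LHS]sA mxE.
(* [s] is [S] with its upper index lowered by [A]. *)
pose s a b c := \sum_l S l a b * A l c.
have sC a b c : s a b c = s b a c by apply: eq_bigr => l _; rewrite sS.
have sD a b c : s a b c + s a c b = al 0 a * A b c.
  rewrite -SA -big_split; apply: eq_bigr => l _ /=.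
  by rewrite (AC b l).
(* Koszul's cyclic sum *)
have sE a b c : s a b c =
    2^-1 * (A a c * al 0 b + A b c * al 0 a - A a b * al 0 c).
  have := sD a b c; have := sD b a c; have := sD c a b.
  rewrite (sC b a c) (sC c a b) (sC c b a) => h1 h2 h3.
  by rewrite (mulrC (A a c)) (mulrC (A b c)) (mulrC (A a b)) -h1 -h2 -h3; field.
(* Lowering the index is injective because [A] is invertible. *)
have rowE : (\row_l S l i j) = \row_l conformal_correction A al l i j.
  rewrite -[LHS](mulmxK uA) -[RHS](mulmxK uA); congr (_ *m _).
  apply/rowP => c; rewrite !mxE.
  transitivity (s i j c); first by apply: eq_bigr => l _; rewrite mxE.
  rewrite sE -conformal_correction_lower//.
  by apply: eq_bigr => l _; rewrite mxE.
by have := congr1 (fun u : 'rV_n => u 0 k) rowE; rewrite !mxE.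
Qed.

(** As [al] vanishes on [v], only the raised covector remains; its proportionality to [v] forces
    [al = mu (v A)]. Evaluating on [v] gives [mu g(v,v) = 0], hence [al = 0]. *)
Lemma conformal_correction_quad_neq A al v (lam : R) : A \in unitmx ->
  (v *m A *m v^T) 0 0 != 0 -> al != 0 -> v *m al^T = 0 ->
  ~ forall k, \sum_i \sum_j conformal_correction A al k i j * v 0 i * v 0 j =
              lam * v 0 k.
Proof.
move=> uA q0 al0 vT0 eqv; set q := (v *m A *m v^T) 0 0 in q0.
(* Solves [- (q/2) (al A^-1) = lam v] as [al A^-1 = mu v]. *)
pose mu := - (2 * lam / q).
have alE : al = mu *: (v *m A).
  rewrite -[LHS](mulmxKV uA) scalemxAl; congr (_ *m _); apply/rowP => k.
  have := eqv k; rewrite conformal_correction_quad vT0 mxE mul0r sub0r -/q.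
  move=> h; rewrite [RHS]mxE /mu mulNr mulrAC -[2 * lam * _]mulrA -h.
  by field.
have : mu * q = 0.
  have := congr1 (fun B : 'M[R]_1 => B 0 0) vT0.
  rewrite alE linearZ /= -scalemxAr -[X in X *m _]trmxK -trmx_mul.
  by rewrite mxE [X in _ * X]mxE [RHS]mxE.
move/eqP; rewrite mulf_eq0 (negPf q0) orbF => /eqP mu0.
by rewrite alE mu0 scale0r eqxx in al0.
Qed.

(** The column [v^T] has rank at most 1, so its left kernel is nonzero once [n] is at least 2. *)
Lemma exists_orthogonal_rV v : (1 < n)%N ->
  exists2 al : 'rV[R]_n, al != 0 & v *m al^T = 0.
Proof.
move=> n1; have : kermx v^T != 0.
  rewrite -mxrank_eq0 mxrank_ker subn_eq0 -ltnNge.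
  by apply: leq_ltn_trans n1; exact: rank_leq_col.
case/rowV0Pn => al /sub_kermxP al_v al0; exists al => //.
by rewrite -[v]trmxK -trmx_mul al_v trmx0.
Qed.

End ConformalCorrection.

(** * Charts, and the change of coordinates of differentials and velocities *)

Section ManifoldCalculus.
Context {R : realType} {n : nat} {M : smooth_manifold R n}.
Implicit Types (a b c : chart_index M) (x : M) (f : M -> R).

Definition coord_image c : set 'rV[R]_n := crd c @` dom c.

Lemma open_coord_image c : open (coord_image c).
Proof. exact: chart_im_open. Qed.

Lemma coord_image_crd c x : dom c x -> coord_image c (crd c x).
Proof. by move=> cx; exists x. Qed.

Lemma crdK c x : dom c x -> icrd c (crd c x) = x.
Proof. exact: coordK. Qed.

Lemma icrdK c u : coord_image c u -> crd c (icrd c u) = u.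
Proof. by move=> [x cx <-]; rewrite crdK. Qed.

Lemma dom_icrd c u : coord_image c u -> dom c (icrd c u).
Proof. by move=> [x cx <-]; rewrite crdK. Qed.

Lemma nbhs_dom c x : dom c x -> nbhs x (dom c).
Proof.
by move=> cx; apply: open_nbhs_nbhs; split=> //; exact: chart_dom_open.
Qed.

Lemma nbhs_coord_image c x : dom c x -> nbhs (crd c x) (coord_image c).
Proof.
move=> cx; apply: open_nbhs_nbhs.
by split; [exact: open_coord_image|exact: coord_image_crd].
Qed.

Lemma icrd_cts c u : coord_image c u -> {for u, continuous (icrd c)}.
Proof.
move=> cu; have := @Defs.icoord_continuous _ _ _ (atlas c).
rewrite continuous_open_subspace; last exact: open_coord_image.
by apply; rewrite inE.
Qed.

Lemma open_icrd_preimage c (A : set M) : open A ->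
  open (coord_image c `&` icrd c @^-1` A).
Proof.
move=> oA; have cts : {in coord_image c, continuous (icrd c : _ -> M)}.
  by move=> u; rewrite inE => /icrd_cts.
exact: (continuous_inP _ (@open_coord_image c)).1 cts _ oA.
Qed.

Lemma overlapE a b :
  crd a @` (dom a `&` dom b) = coord_image a `&` icrd a @^-1` dom b.
Proof.
apply/seteqP; split=> u.
  by move=> [x [ax bx] <-]; split; [exact: coord_image_crd|rewrite /= crdK].
move=> [au bu]; exists (icrd a u); last exact: icrdK.
by split=> //; exact: dom_icrd.
Qed.

Lemma open_overlap a b : open (coord_image a `&` icrd a @^-1` dom b).
Proof. exact/open_icrd_preimage/chart_dom_open. Qed.

Lemma transition_smooth a b :
  smooth_on (coord_image a `&` icrd a @^-1` dom b) (crd b \o icrd a).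
Proof. by rewrite -overlapE; exact: atlas_smooth. Qed.

Lemma transition_differentiable a b x : dom a x -> dom b x ->
  differentiable (crd b \o icrd a) (crd a x).
Proof.
move=> ax bx; have [+ _] := @transition_smooth a b 1%N.
by apply; split; [exact: coord_image_crd|rewrite /= crdK].
Qed.

Lemma smooth_in_chart_differentiable c f x : smooth_in_chart c f -> dom c x ->
  differentiable (f \o icrd c) (crd c x).
Proof. by move=> /(_ 1%N)[+ _] cx; apply; exact: coord_image_crd. Qed.

(** The differential of [f], a covector: no index is raised, and it transforms by the transposed
    Jacobian. *)
Definition gradient c f x : 'rV[R]_n := \row_i pderiv c i f x.

Lemma derive_row (h : 'rV[R]_n -> R) u w : differentiable h u ->
  'D_w h u = \sum_i w 0 i * 'D_(delta_mx 0 i) h u.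
Proof.
move=> dh; rewrite deriveE// [in LHS](row_sum_delta w) linear_sum.
by apply: eq_bigr => i _; rewrite linearZ /= deriveE.
Qed.

Lemma gradient_change a b f x : dom a x -> dom b x -> smooth_in_chart b f ->
  gradient a f x = gradient b f x *m (transition_jacobian a b x)^T.
Proof.
move=> ax bx sf; apply/rowP => i; rewrite !mxE.
have dt := transition_differentiable ax bx.
have df := smooth_in_chart_differentiable sf bx.
have E : (crd b \o icrd a) (crd a x) = crd b x by rewrite /= crdK.
(* The two coordinate expressions of [f] are related by the transition map on the overlap, a
   neighbourhood of the point, so the chain rule applies. *)
rewrite /pderiv (@near_eq_derive _ _ _ _ ((f \o icrd b) \o (crd b \o icrd a))).
  rewrite deriveE; last by apply: differentiable_comp; rewrite ?E.
  rewrite diff_comp ?E //= -deriveE// derive_row//.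
  by apply: eq_bigr => j _; rewrite !mxE mulrC.
have nU : nbhs (crd a x) (coord_image a `&` icrd a @^-1` dom b).
  by apply: open_nbhs_nbhs; split; [exact: open_overlap|
     split; [exact: coord_image_crd|rewrite /= crdK]].
by apply: filterS nU => u [au bu]; rewrite /= crdK.
Qed.

Lemma velocity_change (I : set R) (y : R -> M) t a b :
  smooth_curve I y -> I t -> dom a (y t) -> dom b (y t) ->
  velocity y t b = velocity y t a *m transition_jacobian a b (y t).
Proof.
move=> [U [oU IU] [yc ys]] It ay by_.
rewrite /velocity !asboolT// !derive1E.
have dy : differentiable (crd a \o y) t.
  by have [+ _] := ys a 1%N; apply; split=> //; exact: IU.
have dt := transition_differentiable ay by_.
(* Continuity keeps the curve in [dom a] near [t], where its expression in [b] factors through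
   [a]. *)
rewrite (@near_eq_derive _ _ _ _ ((crd b \o icrd a) \o (crd a \o y))).
  rewrite deriveE; last exact: differentiable_comp dy dt.
  by rewrite diff_comp //= -(deriveE _ dy) -deriveE// deriveEjacobian.
have : nbhs (y t) (dom a) by exact: nbhs_dom.
move/(yc t (IU t It)) => yta; near=> s.
by rewrite /= crdK//; near: s.
Unshelve. all: by end_near.
Qed.

Lemma velocity_tangent (I : set R) (y : R -> M) t :
  smooth_curve I y -> I t -> tangent_space (y t) (velocity y t).
Proof.
move=> sy It; split=> [c|a b]; first by rewrite /velocity => /asboolF->.
exact: velocity_change sy It.
Qed.

End ManifoldCalculus.

(** * The Levi-Civita connection of the conformal metric *)

Section ConformalConnection.
Context {R : realType} {n : nat} {M : smooth_manifold R n}.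
Variables (p q : nat) (g : tensor2 M) (sigma : M -> R).
Hypotheses (hg : pseudo_riemannian p q g).
Hypotheses (smooth_sigma : smooth_function sigma).
Hypotheses (sigma_gt0 : forall y, 0 < sigma y).
Implicit Types (a b c : chart_index M) (x : M) (Gamma : connection_coef M).

Lemma has_signature_unitmx (A : 'M[R]_n) : has_signature p q A -> A \in unitmx.
Proof.
move=> [_ [P uP PAP]].
have : P *m A *m P^T \in unitmx.
  rewrite PAP unitmxE det_diag unitfE; apply/prodf_neq0 => i _; rewrite mxE.
  by case: ifP => _; rewrite ?oppr_eq0 oner_eq0.
by rewrite !unitmx_mul => /andP[/andP[]].
Qed.

Lemma metric_unitmx c x : dom c x -> g c x \in unitmx.
Proof. by move=> cx; apply/has_signature_unitmx/(metric_signature hg cx). Qed.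

(** In [g_a = J g_b J^T] the left side is invertible, hence so is the factor [J]. *)
Lemma transition_jacobian_unitmx a b x : dom a x -> dom b x ->
  transition_jacobian a b x \in unitmx.
Proof.
move=> ax bx; have := metric_unitmx ax.
by rewrite (metric_tensor hg ax bx) !unitmx_mul => /andP[/andP[]].
Qed.

(** The differential of [ln sigma], written without the logarithm. *)
Definition dlog c x : 'rV[R]_n := (sigma x)^-1 *: gradient c sigma x.

Lemma dlog_change a b x : dom a x -> dom b x ->
  dlog a x = dlog b x *m (transition_jacobian a b x)^T.
Proof. by move=> ax bx; rewrite /dlog (gradient_change ax bx)// scalemxAl. Qed.

Lemma sigma_neq0 x : sigma x != 0.
Proof. by rewrite gt_eqF. Qed.

Lemma pderiv_conformal c x k i j : dom c x ->
  pderiv c k (fun y => conformal sigma g c y i j) x =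
  sigma x * (pderiv c k (fun y => g c y i j) x + dlog c x 0 k * g c x i j).
Proof.
move=> cx.
have ds := smooth_in_chart_differentiable (smooth_sigma c) cx.
have dg := smooth_in_chart_differentiable (metric_smooth hg c i j) cx.
rewrite /pderiv.
rewrite (_ : _ \o _ = (sigma \o icrd c) * ((fun y => g c y i j) \o icrd c)).
  rewrite deriveM; [|exact: diff_derivable..].
  rewrite /= crdK// /GRing.scale /= !mxE /pderiv; field; exact: sigma_neq0.
by rewrite funeqE => u; rewrite /conformal /= mxE.
Qed.

Definition conformal_connection Gamma : connection_coef M := fun c x k i j =>
  Gamma c x k i j + conformal_correction (g c x) (dlog c x) k i j.

Lemma smooth_in_chart_dlog c i : smooth_in_chart c (fun x => dlog c x 0 i).
Proof.
move=> k; apply: (@Ck_on_eq _ _ _ _ _ (fun u =>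
  ((sigma \o icrd c) u)^-1 * 'D_(delta_mx 0 i) (sigma \o icrd c) u)).
- exact: open_coord_image.
- by move=> u cu; rewrite /= !mxE /pderiv icrdK.
apply: Ck_onM; first exact: open_coord_image.
  apply: Ck_onV; first exact: open_coord_image.
    by move=> u _; exact: sigma_neq0.
  exact: smooth_sigma.
by have [_ +] := smooth_sigma c k.+1; exact.
Qed.

Lemma smooth_conformal_correction c k i j :
  smooth_in_chart c (fun x => conformal_correction (g c x) (dlog c x) k i j).
Proof.
move=> m; have oU := @open_coord_image _ _ M c.
have cst (z : R) : Ck_on m (crd c @` dom c) (fun _ : 'rV[R]_n => z).
  exact: Ck_on_cst.
have cg i' j' := metric_smooth hg c i' j' m.
have cd i' := @smooth_in_chart_dlog c i' m.
apply: (Ck_onM oU (cst _)); apply: (Ck_onD oU).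
  by apply: (Ck_onD oU); exact: (Ck_onM oU (cst _) (cd _)).
apply: (@Ck_on_eq _ _ _ _ _ (fun u => -1 *
   (g c (icrd c u) i j *
    \sum_l dlog c (icrd c u) 0 l * invmx (g c (icrd c u)) l k))) => //.
  by move=> u _; rewrite mxE mulN1r.
apply: (Ck_onM oU (cst _)); apply: (Ck_onM oU (cg _ _)).
apply: (Ck_on_sum oU) => l; apply: (Ck_onM oU (cd _)).
by apply: (Ck_on_invmx oU) => // u /dom_icrd; exact: metric_unitmx.
Qed.

Lemma levi_civita_conformal Gamma : levi_civita g Gamma ->
  levi_civita (conformal sigma g) (conformal_connection Gamma).
Proof.
move=> [[sG cG] tG mG]; split.
- split=> [c k i j m|a b x ax bx l i j J].
    apply: Ck_onD; first exact: open_coord_image.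
      exact: sG.
    exact: smooth_conformal_correction.
  rewrite /conformal_connection.
  under eq_bigr do rewrite mulrDl.
  (* The inhomogeneous term is carried by [Gamma]; what remains is the tensor law of the
     correction. *)
  rewrite big_split /= (cG a b x)// -addrA; congr (_ + _).
  rewrite (@conformal_correction_change _ _ _ (g b x) J _ (dlog b x)) //.
  + rewrite -big_split; apply: eq_bigr => r _; rewrite -big_split.
    by apply: eq_bigr => s _; rewrite mulrDr.
  + exact: (metric_tensor hg).
  + exact: dlog_change.
  + exact: transition_jacobian_unitmx.
  + exact: metric_unitmx.
- move=> c x cx k i j; rewrite /conformal_connection tG//.
  by rewrite conformal_correctionC// (Defs.metric_sym hg).
- move=> c x cx k i j; rewrite pderiv_conformal// mG//.
  have sg := Defs.metric_sym hg cx.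
  have gC u v : g c x u v = g c x v u by rewrite -[in LHS]sg mxE.
  have uA := metric_unitmx cx.
  have E1 := conformal_correction_lower (dlog c x) k i j uA.
  have E2 := conformal_correction_lower (dlog c x) k j i uA.
  transitivity (sigma x * (\sum_l (Gamma c x l k i * g c x l j
     + Gamma c x l k j * g c x i l)
     + (\sum_l conformal_correction (g c x) (dlog c x) l k i * g c x l j
     + \sum_l conformal_correction (g c x) (dlog c x) l k j * g c x l i))).
    by congr (_ * (_ + _)); rewrite E1 E2 (gC j i); field.
  rewrite -!big_split mulr_sumr; apply: eq_bigr => l _ /=.
  by rewrite /conformal_connection /conformal !mxE (gC l i); ring.
Qed.

(** A geodesic of [sigma g] only comes with some Levi-Civita connection; this identifies its
    coefficients with the explicit ones. *)
Lemma levi_civita_conformal_unique Gamma Gamma' c x k i j :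
  levi_civita g Gamma -> levi_civita (conformal sigma g) Gamma' -> dom c x ->
  Gamma' c x k i j = conformal_connection Gamma c x k i j.
Proof.
move=> [_ tG mG] [_ tG' mG'] cx.
have sg := Defs.metric_sym hg cx.
pose S k i j := Gamma' c x k i j - Gamma c x k i j.
rewrite /conformal_connection.
rewrite -(@conformal_correction_unique _ _ _ _ S) ?/S ?subrKC//.
- exact: metric_unitmx.
- by move=> *; rewrite tG// tG'.
(* Multiplied by [sigma x], the goal is the difference of the two metric compatibility equations. *)
move=> k' i' j'; apply: (mulfI (sigma_neq0 x)).
have := mG' c x cx k' i' j'; rewrite pderiv_conformal// mG// mulrDr.
move/eqP; rewrite eq_sym addrC -subr_eq => /eqP <-.
rewrite !mulr_sumr -sumrB; apply: eq_bigr => l _.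
by rewrite /conformal !mxE; ring.
Qed.

(** The second derivatives of the coordinates agree. The coefficients are compared only at [y t],
    which suits both the explicit connection and a given one. *)
Lemma acceleration_conformal Gamma Gamma' (y : R -> M) t c :
  dom c (y t) ->
  (forall k i j,
     Gamma' c (y t) k i j = conformal_connection Gamma c (y t) k i j) ->
  acceleration Gamma' y t c = acceleration Gamma y t c
    + \row_k \sum_i \sum_j conformal_correction (g c (y t)) (dlog c (y t)) k i j
        * velocity y t c 0 i * velocity y t c 0 j.
Proof.
move=> cy GE; rewrite /acceleration !asboolT// -addrA; congr (_ + _).
apply/rowP => k; rewrite !mxE -big_split; apply: eq_bigr => i _.
rewrite -big_split; apply: eq_bigr => j _.
by rewrite GE /conformal_connection /=; ring.
Qed.

End ConformalConnection.

(** * Bump functions, and conformal factors with prescribed direction of the differential *)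

Section ConformalFactor.
Context {R : realType} {n : nat} {M : smooth_manifold R n}.
Implicit Types (c : chart_index M) (x : M).

Definition extend_by_zero c (F : 'rV[R]_n -> R) : M -> R :=
  fun y => if `[< dom c y >] then F (crd c y) else 0.

(** On the chart domain the function is [F] composed with a transition map, which is why smoothness
    of [F] is asked in composed form; elsewhere it vanishes off the image of [K]. *)
Lemma smooth_extend_by_zero c (K : set 'rV[R]_n) (F : 'rV[R]_n -> R) :
  compact K -> K `<=` coord_image c -> (forall u, ~ K u -> F u = 0) ->
  (forall (U : set 'rV[R]_n) (phi : 'rV[R]_n -> 'rV[R]_n),
     open U -> smooth_on U phi -> smooth_on U (F \o phi)) ->
  smooth_function (extend_by_zero c F).
Proof.
move=> cK Kc F0 sF b k; apply: Ck_on_local => u bu.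
have [cu|ncu] := pselect (dom c (icrd b u)).
  exists (coord_image b `&` icrd b @^-1` dom c); first by split.
  have oU : open (coord_image b `&` icrd b @^-1` dom c) by exact: open_overlap.
  have := sF _ _ oU (@transition_smooth _ _ _ b c) k.
  apply: Ck_on_eq => // w [bw cw].
  by rewrite /extend_by_zero /= asboolT.
(* A compact subset of a Hausdorff space is closed, so its complement is an open set around the
   point on which the function is 0. *)
have oK : open (~` (icrd c @` K)).
  rewrite openC; apply: compact_closed; first exact: point_hausdorff.
  apply: continuous_compact => //; apply: continuous_subspaceW Kc _.
  exact: Defs.icoord_continuous.
exists (coord_image b `&` icrd b @^-1` (~` (icrd c @` K))).
  by split=> // -[w /Kc cw wE]; apply: ncu; rewrite -wE; exact: dom_icrd.
apply: (@Ck_on_eq _ _ _ _ _ (fun=> 0)).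
- exact: open_icrd_preimage.
- move=> w [bw nKw]; rewrite /extend_by_zero /=; case: asboolP => // cw.
  rewrite F0// => Kw; apply: nKw; exists (crd c (icrd b w)) => //.
  by rewrite crdK.
- exact: Ck_on_cst.
Qed.

Section Bump.
Variables (r : R) (cen : 'rV[R]_n).
Hypothesis r_gt0 : 0 < r.

Definition bump_gap (u : 'rV[R]_n) : R :=
  r ^+ 2 - \sum_i (u 0 i - cen 0 i) ^+ 2.

(** Equals [exp(-1/(r^2 - |u - cen|^2))] in the open Euclidean ball and 0 outside. *)
Definition bump_fun (u : 'rV[R]_n) : R := flat 0 (bump_gap u).

Lemma bump_fun_ge0 (u : 'rV[R]_n) : 0 <= bump_fun u.
Proof. exact: flat_ge0. Qed.

(** The support is enclosed in a cube, compact as a product of segments: one coordinate off by more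
    than [r] already makes the gap nonpositive. *)
Lemma bump_fun_eq0 (u : 'rV[R]_n) :
  ~ (forall i, u 0 i \in `[cen 0 i - r, cen 0 i + r]) -> bump_fun u = 0.
Proof.
move=> /existsNP[i /negP ui]; rewrite /bump_fun flat_le0// /bump_gap subr_le0.
rewrite (bigD1 i)//= -[leLHS]addr0 lerD//; last first.
  by apply: sumr_ge0 => j _; rewrite sqr_ge0.
rewrite -[leRHS]real_normK ?num_real// ler_pXn2r ?nnegrE ?(ltW r_gt0)//.
apply: ltW; rewrite ltNge; apply: contra ui.
by rewrite ler_distl in_itv /= => /andP[-> ->].
Qed.

Lemma smooth_bump_fun (V : normedModType R) (U : set V) (phi : V -> 'rV[R]_n) :
  open U -> smooth_on U phi -> smooth_on U (bump_fun \o phi).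
Proof.
move=> oU sphi k; apply: Ck_on_flat => //; rewrite /bump_gap.
have cphi i : Ck_on k U (fun z => phi z 0 i) by exact: Ck_on_coord.
have cst (z : R) : Ck_on k U (fun=> z) by exact: Ck_on_cst.
apply: (@Ck_on_eq _ _ _ _ _ (fun z => r ^+ 2 + -1 *
   \sum_i ((phi z 0 i + - cen 0 i) * (phi z 0 i + - cen 0 i)))) => //.
  by move=> z _; rewrite mulN1r.
apply: (Ck_onD oU (cst _)); apply: (Ck_onM oU (cst _)).
apply: (Ck_on_sum oU) => i.
by apply: (Ck_onM oU); apply: (Ck_onD oU).
Qed.

Lemma is_derive_bump_fun (u v : 'rV[R]_n) :
  is_derive u v bump_fun
    (- 2 * flat 2 (bump_gap u) * \sum_i (u 0 i - cen 0 i) * v 0 i).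
Proof.
pose h i : 'rV[R]_n -> R := ((fun w : 'rV[R]_n => w 0 i) - cst (cen 0 i)) ^+ 2.
have bump_gapE : bump_gap = cst (r ^+ 2) - \sum_i h i.
  by rewrite funeqE => w; rewrite /bump_gap /h !fctE fct_sumE.
have dc i : differentiable (fun w : 'rV[R]_n => w 0 i : R) u.
  exact: differentiable_coord.
have dgap : differentiable bump_gap u.
  rewrite bump_gapE; apply: differentiableB; first exact: differentiable_cst.
  apply: differentiable_sum => i; apply: differentiableX.
  by apply: differentiableB => //; exact: differentiable_cst.
apply: DeriveDef.
  apply: diff_derivable.
  apply: (@differentiable_comp _ _ _ _ bump_gap (flat 0)) => //.
  exact: differentiable_flat.
rewrite (@derive_comp1 _ _ (flat 0) bump_gap) //; last first.
  exact: differentiable_flat.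
rewrite derive1E (@derive_val _ _ _ _ _ _ _ (is_derive_flat 0 (bump_gap u))).
have isc i : is_derive u v (fun w : 'rV[R]_n => w 0 i : R) (v 0 i).
  apply: DeriveDef; first exact: diff_derivable.
  by rewrite (@derive_coord _ _ _ _ id)// derive_id.
have ish i :
    is_derive u v (h i) ((2%:R * (u 0 i - cen 0 i) ^+ 1) *: (v 0 i - 0)).
  by rewrite /h; apply: is_deriveX.
have -> : 'D_v bump_gap u =
    0 - \sum_i ((2%:R * (u 0 i - cen 0 i) ^+ 1) *: (v 0 i - 0)).
  rewrite bump_gapE; apply: derive_val.
(* For [m = 0] the first term in the derivative of [flat m] vanishes, leaving [flat 2]. *)
rewrite mulr0n oppr0 mul0r add0r sub0r -sumrN !mulr_sumr.
by apply: eq_bigr => i _; rewrite /GRing.scale /=; ring.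
Qed.

End Bump.

(** The gradient of a bump points towards its centre, and the centre is displaced from [x] along
    [al]. *)
Lemma exists_conformal_factor c x (al : 'rV[R]_n) : dom c x ->
  exists sigma : M -> R, [/\ smooth_function sigma, forall y, 0 < sigma y &
    exists2 mu, mu != 0 & dlog sigma c x = mu *: al].
Proof.
move=> cx; have [del /= del0 cball] := (nbhs_ballP _ _).1 (nbhs_coord_image cx).
set A := \sum_i al 0 i ^+ 2.
have A0 : 0 <= A by apply: sumr_ge0 => i _; rewrite sqr_ge0.
have A1 : 0 < 1 + A by lra.
(* Both [u0] and [K] lie entrywise within [r] of [cen], so [K] is within [2 r < del] of [u0]. The
   displacement has squared length [eps^2 A < eps^2 (1 + A)^2 = r^2], even when [al = 0]. *)
pose r := del / 4; pose eps := r / (1 + A).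
have r0 : 0 < r by rewrite divr_gt0.
have eps0 : 0 < eps by rewrite divr_gt0.
set u0 := crd c x in cball; pose cen := u0 + eps *: al.
have gap0 : 0 < bump_gap r cen u0.
  rewrite /bump_gap subr_gt0.
  have -> : \sum_i (u0 0 i - cen 0 i) ^+ 2 = eps ^+ 2 * A.
    by rewrite mulr_sumr; apply: eq_bigr => i _; rewrite !mxE; ring.
  have -> : r = eps * (1 + A) by rewrite divfK ?gt_eqF.
  rewrite [ltRHS]exprMn ltr_pM2l ?exprn_gt0//.
  by nra.
pose K := [set u : 'rV[R]_n | forall i, u 0 i \in `[cen 0 i - r, cen 0 i + r]].
have cK : compact K.
  apply: (@rV_compact _ _ (fun i => `[cen 0 i - r, cen 0 i + r]%classic)).
  by move=> i; exact: segment_compact.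
have KU : K `<=` coord_image c.
  move=> u Ku; apply: cball; split=> // i j; rewrite ord1 /ball /=.
  have u0j : `|u0 0 j - cen 0 j| < r.
    rewrite -(@ltr_pXn2r _ 2) ?nnegrE ?(ltW r0)// real_normK ?num_real//.
    apply: le_lt_trans (_ : _ <= \sum_k (u0 0 k - cen 0 k) ^+ 2) _; last first.
      by move: gap0; rewrite /bump_gap subr_gt0.
    rewrite (bigD1 j)//= lerDl; apply: sumr_ge0 => k _; exact: sqr_ge0.
  have uj : `|u 0 j - cen 0 j| <= r.
    by have := Ku j; rewrite ler_distl in_itv.
  move: u0j uj; rewrite ltr_norml ler_norml ltr_norml => /andP[? ?] /andP[? ?].
  have delE : del = 4 * r by rewrite /r; field.
  by apply/andP; split; lra.
have F0 u : ~ K u -> bump_fun r cen u = 0 by exact: bump_fun_eq0.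
pose sigma y := 1 + extend_by_zero c (bump_fun r cen) y.
have sigma_gt0 y : 0 < sigma y.
  rewrite ltr_pwDl// /extend_by_zero; case: asboolP => // _.
  exact: bump_fun_ge0.
exists sigma; split=> //.
  move=> b k; apply: Ck_onD; first exact: open_coord_image.
    exact: Ck_on_cst.
  apply: (smooth_extend_by_zero cK KU F0) => U phi oU.
  exact: smooth_bump_fun.
exists ((sigma x)^-1 * (2 * flat 2 (bump_gap r cen u0) * eps)).
  by rewrite !mulf_neq0 ?invr_eq0// ?gt_eqF// flat_gt0.
rewrite /dlog -scalerA; congr (_ *: _); apply/rowP => i; rewrite !mxE /pderiv.
rewrite (@near_eq_derive _ _ _ _ (cst 1 + bump_fun r cen)); last first.
  apply: filterS (nbhs_coord_image cx) => u cu.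
  rewrite /sigma /extend_by_zero /= asboolT ?icrdK//; exact: dom_icrd.
have [dbump bumpE] := is_derive_bump_fun r cen u0 (delta_mx 0 i).
rewrite deriveD//.
rewrite derive_cst add0r bumpE.
(* Here [u0 - cen = - eps al], whose sign cancels that of the factor [-2]. *)
rewrite (eq_bigr (fun j => (j == i)%:R * (- (eps * al 0 j)))).
  by rewrite sum_delta; ring.
by move=> j _; rewrite !mxE eqxx /=; ring.
Qed.

End ConformalFactor.

(** * Invariance of isotropic geodesics, and its converse *)

Theorem theorem2 (R : realType) (n p q : nat) (M : smooth_manifold R n)
    (g : tensor2 M) (hpq : (p + q)%N = n) (hq : (0 < q < n)%N)
    (hg : pseudo_riemannian p q g) :
  (forall sigma : M -> R, smooth_function sigma -> (forall y, 0 < sigma y) ->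
     forall (I : set R) (x : R -> M),
       isotropic_geodesic g I x -> isotropic_geodesic (conformal sigma g) I x)
  /\
  (forall (I : set R) (x : R -> M),
     geodesic g I x ->
     (forall sigma : M -> R, smooth_function sigma -> (forall y, 0 < sigma y) ->
        geodesic (conformal sigma g) I x) ->
     isotropic_geodesic g I x).
Proof.
split=> [sigma ssigma sigma0 I x [[rx [Gamma LC [phi geo]]] iso]|I x gx gsx].
  split; last first.
    move=> t It; have [tv qv] := iso t It; split=> // c cx.
    by rewrite /conformal -scalemxAr -scalemxAl mxE qv// mulr0.
  split=> //; exists (conformal_connection g sigma Gamma).
    exact: (levi_civita_conformal hg).
  (* The new factor is [phi + dlog(v)]; it has to be one function of [t], so [dlog(v)] is computed
     in a chart chosen around each [x t]. *)
  pose c0 t := sval (cid (atlas_cover (x t))).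
  exists (fun t =>
    phi t + (velocity x t (c0 t) *m (dlog sigma (c0 t) (x t))^T) 0 0).
  move=> t It; rewrite funeqE => c.
  have [tv qv] := iso t It.
  have [cx|ncx] := pselect (dom c (x t)); last first.
    (* Outside the chart domain both sides are 0 by convention. *)
    have v0 : velocity x t c = 0 by rewrite /velocity asboolF.
    rewrite -[RHS]/((phi t + _) *: velocity x t c) v0 scaler0.
    by rewrite /acceleration asboolF.
  have c0x : dom (c0 t) (x t) := svalP (cid (atlas_cover (x t))).
  rewrite (acceleration_conformal cx (fun _ _ _ => erefl)) geo//.
  rewrite -[RHS]/((phi t + _) *: velocity x t c) scalerDl; congr (_ + _).
  apply/rowP => k; rewrite mxE [RHS]mxE conformal_correction_quad qv//.
  rewrite mulr0 mul0r subr0.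
  (* The pairing of a covector with a vector is the same in the charts [c] and [c0 t]. *)
  congr (_ * _); rewrite (tv.2 _ _ c0x cx) (dlog_change ssigma c0x cx).
  by rewrite trmx_mul trmxK mulmxA.
split=> // t It; have [[_ _ sx _] _] := gx.
split; first exact: velocity_tangent sx It.
move=> c cx; apply/eqP/negPn/negP => q0.
have n1 : (1 < n)%N by case/andP: hq => q_gt0; exact: leq_ltn_trans.
have [al al0 val0] := exists_orthogonal_rV (velocity x t c) n1.
have [sigma [ssigma sigma0 [mu mu0 dlogE]]] := exists_conformal_factor al cx.
have [_ [Gamma LC [phi geo]]] := gx.
have [_ [Gamma' LC' [phi' geo']]] := gsx sigma ssigma sigma0.
have uA := metric_unitmx hg cx.
(* Both accelerations are multiples of the velocity, so their difference is [phi' t - phi t] times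
   it. *)
apply: (@conformal_correction_quad_neq _ _ _ (dlog sigma c (x t)) _
         (phi' t - phi t) uA q0).
- by rewrite dlogE scaler_eq0 negb_or mu0.
- by rewrite dlogE linearZ /= -scalemxAr val0 scaler0.
move=> k.
have := acceleration_conformal cx
  (fun k i j => levi_civita_conformal_unique hg ssigma sigma0 k i j LC LC' cx).
rewrite (congr1 (fun f => f c) (geo t It)) (congr1 (fun f => f c) (geo' t It)).
move/(congr1 (fun w : 'rV[R]_n => w 0 k)).
rewrite !mxE => E.
by rewrite mulrBl; apply/eqP; rewrite eq_sym subr_eq addrC; apply/eqP.
Qed.
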